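(* Let $G$ and $H$ be graphs of orders $n\ge 2$ and $n'\ge 2$, respectively. If $\gamma_{\rm sp}(G)=\frac{n}{2}$ or $\gamma_{\rm sp}(H)=\frac{n'}{2}$, then $$\gamma_{\rm sp}(G\Box H)=\frac{nn'}{2}.$$
   Context: All graphs are finite, simple and undirected. For a vertex $v$, $N(v)$ is its set of neighbours; for $D\subseteq V(G)$, $\overline{D}=V(G)\setminus D$. A set $D\subseteq V(G)$ is a super dominating set of $G$ if for every $u\in\overline{D}$ there exists $v\in D$ such that $N(v)\cap\overline{D}=\{u\}$; the super domination number $\gamma_{\rm sp}(G)$ is the minimum cardinality of a super dominating set of $G$. The Cartesian product $G\Box H$ has vertex set $V(G)\times V(H)$, with $(g,h)$ adjacent to $(g',h')$ iff either $g=g'$ and $hh'\in E(H)$, or $gg'\in E(G)$ and $h=h'$. *)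

(* Defs.v *)
From HB Require Import structures.
From mathcomp Require Import all_boot all_order all_algebra.

Set Implicit Arguments.
Unset Strict Implicit.
Unset Printing Implicit Defensive.

Record sgraph := SGraph {
  vertex :> finType;
  adj : rel vertex;
  adj_sym : symmetric adj;
  adj_irrefl : irreflexive adj
}.

Definition nbhd (G : sgraph) (v : G) : {set G} := [set u | adj v u].

Definition super_dominating (G : sgraph) (D : {set G}) : bool :=
  [forall u in ~: D, exists v in D, nbhd v :&: ~: D == [set u]].

Lemma super_dominatingP (G : sgraph) (D : {set G}) :
  reflect (forall u, u \in ~: D ->
             exists2 v, v \in D & nbhd v :&: ~: D = [set u])
          (super_dominating D).
Proof.
apply: (iffP forall_inP) => [DP u /DP /exists_inP[v vD /eqP]|DP u /DP[v vD vu]].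
  by exists v.
by apply/exists_inP; exists v => //; apply/eqP.
Qed.

Lemma super_dominatingT (G : sgraph) : super_dominating [set: G].
Proof. by apply/super_dominatingP => u; rewrite setCT inE. Qed.

(* The whole vertex set is super dominating (super_dominatingT), so the
   starting value of the search for a minimum is an admissible one. *)
Definition super_dom_number (G : sgraph) : nat :=
  #|[arg min_(D < [set: G] | super_dominating D) #|D|]|.

Lemma super_dom_numberP (G : sgraph) :
  (exists2 D : {set G}, super_dominating D & #|D| = super_dom_number G)
  /\ (forall D : {set G}, super_dominating D -> super_dom_number G <= #|D|).
Proof.
rewrite /super_dom_number; case: arg_minnP => [|D DP Dmin].
  exact: super_dominatingT.
by split=> //; exists D.
Qed.

Definition cart_adj (G H : sgraph) : rel (G * H) :=
  fun x y => (x.1 == y.1) && adj x.2 y.2 || adj x.1 y.1 && (x.2 == y.2).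

Lemma cart_adj_sym (G H : sgraph) : symmetric (@cart_adj G H).
Proof.
move=> x y; rewrite /cart_adj.
by rewrite (adj_sym x.1) (adj_sym x.2) (eq_sym x.1) (eq_sym x.2).
Qed.

Lemma cart_adj_irrefl (G H : sgraph) : irreflexive (@cart_adj G H).
Proof. by move=> x; rewrite /cart_adj !adj_irrefl andbF. Qed.

Definition cart_prod (G H : sgraph) : sgraph :=
  SGraph (@cart_adj_sym G H) (@cart_adj_irrefl G H).

(* Main.v *)
(* If D is super dominating, choosing for each u outside D a vertex v of D whose
   only neighbour outside D is u is injective, so |V| <= 2 |D|. Conversely, if
   D is super dominating in G then D x V(H) is super dominating in G [] H: the
   copies of H over D add no outside neighbours. Both bounds meet at half the
   order. *)
Require Import Defs.
From HB Require Import structures.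
From mathcomp Require Import all_boot all_order all_algebra.

Set Implicit Arguments.
Unset Strict Implicit.
Unset Printing Implicit Defensive.

Import Order.TTheory GRing.Theory Num.Theory.
Local Open Scope ring_scope.

Lemma card_le_double_super_dominating (G : sgraph) (D : {set G}) :
  super_dominating D -> (#|G| <= #|D|.*2)%N.
Proof.
move=> /super_dominatingP DP.
(* The default [u] only makes [f] total; outside [D] the pick always succeeds. *)
pose f (u : G) := odflt u [pick v in D | nbhd v :&: ~: D == [set u]].
have fP u : u \in ~: D -> f u \in D /\ nbhd (f u) :&: ~: D = [set u].
  move=> /DP[v vD vu]; rewrite /f.
  case: pickP => [w /andP[wD /eqP wu] //|/(_ v)].
  by rewrite vD vu eqxx.
have f_inj : {in ~: D &, injective f}.
  move=> u w /fP[_ fu] /fP[_ fw] fuw.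
  by apply/set1_inj; rewrite -fu -fw fuw.
(* Cancelling [#|D|] leaves [#|~: D| <= #|D|], and [f] injects [~: D] into [D]. *)
rewrite -(cardsC D) -addnn leq_add2l -(card_in_imset f_inj).
by apply/subset_leq_card/subsetP => _ /imsetP[u /fP[fuD _] ->].
Qed.

Lemma card_le_double_super_dom_number (G : sgraph) :
  (#|G| <= (super_dom_number G).*2)%N.
Proof.
have [[D DP <-] _] := super_dom_numberP G.
exact: card_le_double_super_dominating.
Qed.

Lemma super_dominating_setXT (G H : sgraph) (D : {set G}) :
  super_dominating D -> super_dominating (setX D [set: H] : {set cart_prod G H}).
Proof.
move=> /super_dominatingP DP; apply/super_dominatingP => -[u h].
rewrite !inE andbT -in_setC => /DP[v vD vu].
exists (v, h); first by rewrite !inE vD.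
apply/setP => -[a b]; move/setP/(_ a): vu.
rewrite !inE /= /cart_adj /= xpair_eqE andbT => <-.
(* If [a = v], then [(a, b)] lies over [D] and both sides are false; otherwise only edges of [G] can
   join [(v, h)] to [(a, b)]. *)
rewrite (eq_sym h); case: (eqVneq v a) => [<-|_] /=; last by rewrite andbAC.
by rewrite vD !andbF.
Qed.

(** Mirror case for the second factor: edges in the [G] direction keep the coordinate [v], which is
    in [D]. *)
Lemma super_dominating_setTX (G H : sgraph) (D : {set H}) :
  super_dominating D -> super_dominating (setX [set: G] D : {set cart_prod G H}).
Proof.
move=> /super_dominatingP DP; apply/super_dominatingP => -[g u].
rewrite !inE /= -in_setC => /DP[v vD vu].
exists (g, v); first by rewrite !inE vD.
apply/setP => -[a b]; move/setP/(_ b): vu.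
rewrite !inE /= /cart_adj /= xpair_eqE => <-.
rewrite (eq_sym g); case: (eqVneq v b) => [<-|_] /=.
  by rewrite vD !andbF.
by rewrite andbF orbF andbA.
Qed.

Lemma super_dom_number_cart_prod_lel (G H : sgraph) :
  (super_dom_number (cart_prod G H) <= super_dom_number G * #|H|)%N.
Proof.
have [[D DP <-] _] := super_dom_numberP G.
have [_ /(_ _ (super_dominating_setXT H DP))] := super_dom_numberP (cart_prod G H).
by rewrite cardsX cardsT.
Qed.

Lemma super_dom_number_cart_prod_ler (G H : sgraph) :
  (super_dom_number (cart_prod G H) <= #|G| * super_dom_number H)%N.
Proof.
have [[D DP <-] _] := super_dom_numberP H.
have [_ /(_ _ (super_dominating_setTX G DP))] := super_dom_numberP (cart_prod G H).
by rewrite cardsX cardsT.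
Qed.

(** Moves exact halves in [rat] to [nat], where the cardinality bounds live. *)
Lemma natr_eq_half (a b : nat) : a%:R = b%:R / 2 :> rat <-> a.*2 = b.
Proof.
have two_neq0 : 2 != 0 :> rat by [].
split=> [ab|<-]; last by rewrite -muln2 natrM mulfK.
by apply/eqP; rewrite -(eqr_nat rat) -muln2 natrM ab divfK.
Qed.

Theorem theorem22 (G H : sgraph) (n n' : nat)
    (orderG : #|G| = n) (orderH : #|H| = n')
    (n_ge2 : (2 <= n)%N) (n'_ge2 : (2 <= n')%N)
    (half : (super_dom_number G)%:R = n%:R / 2 :> rat \/
            (super_dom_number H)%:R = n'%:R / 2 :> rat) :
  (super_dom_number (cart_prod G H))%:R = n%:R * n'%:R / 2 :> rat.
Proof.
rewrite -natrM; apply/natr_eq_half/eqP; rewrite eqn_leq; apply/andP; split; last first.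
  (* Lower bound: the general inequality applied to the product graph, of order [n * n']. *)
  by rewrite -orderG -orderH -card_prod; apply: card_le_double_super_dom_number.
(* Upper bound: the order of the extremal factor is replaced by twice its super domination number,
   and the 2 cancels. *)
case: half => /natr_eq_half <-.
  by rewrite -doubleMl leq_double -orderH super_dom_number_cart_prod_lel.
by rewrite -doubleMr leq_double -orderG super_dom_number_cart_prod_ler.
Qed.
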